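(* Let $b\ge1$ be an integer and let $g(t)=\sum_{k=-b}^{b}a_k\exp(j2\pi kt)$, $a_k\in\mathbb{C}$, be real-valued with $|g(t)|\le1$ for all $t\in\mathbb{R}$. Let $U_1,U_2,\ldots$ be i.i.d. random variables uniform on $[0,1]$ and let $U_{1:n}\le U_{2:n}\le\cdots\le U_{n:n}$ be the order statistics of $U_1,\ldots,U_n$. Let $\vec a=[a_{-b},\ldots,a_b]^T$, and let $\vec A=[\widehat A_{-b},\ldots,\widehat A_b]^T$ and $\widehat G(t)$ be the estimates (depending on $n$) $$\vec A=\frac{1}{2b+1}\Phi_b^\dagger\vec G,\qquad \widehat G(t)=\sum_{k=-b}^{b}\widehat A_k\exp(j2\pi kt),$$ with $\Phi_b$ and $\vec G$ as defined in the context. Then, as $n\to\infty$, $\vec A\to\vec a$ almost surely and in $\mathcal{L}^2$, and, for each $t$, $\widehat G(t)\to g(t)$ almost surely and in $\mathcal{L}^2$.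
   Context: Notation: $j=\sqrt{-1}$; $s_b:=1/(2b+1)$; $\phi_k:=\exp(j2\pi k s_b)$; $[x]$ denotes the integer part of $x$. $\Phi_b$ is the $(2b+1)\times(2b+1)$ matrix with rows indexed by $l=0,1,\ldots,2b$, columns indexed by $k=-b,\ldots,b$, and $(l,k)$ entry $(\phi_k)^l$; $\Phi_b^\dagger$ is its conjugate transpose. $\vec G$ is the vector of field samples $$\vec G=\bigl[g(U_{1:n}),\,g(U_{[ns_b]+1:n}),\,\ldots,\,g(U_{[n2bs_b]+1:n})\bigr]^T,$$ i.e. its entry with index $l\in\{0,\ldots,2b\}$ is $g(U_{[nls_b]+1:n})$. $\mathcal{L}^2$ convergence $X_n\to X$ means $\mathbb{E}\|X_n-X\|^2\to0$. *)

(* Defs.v *)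
From mathcomp Require Import all_boot all_order all_algebra.
From mathcomp Require Import all_classical all_reals all_analysis.
From mathcomp Require Import complex spectral.

Set Implicit Arguments.
Unset Strict Implicit.
Unset Printing Implicit Defensive.

Import Order.TTheory GRing.Theory Num.Theory numFieldNormedType.Exports.

Local Open Scope classical_set_scope.
Local Open Scope ring_scope.
Local Open Scope complex_scope.
Local Open Scope sesquilinear_scope.

Definition cexp (R : realType) (z : R[i]) : R[i] :=
  (expR (complex.Re z) * cos (complex.Im z)) +i*
  (expR (complex.Re z) * sin (complex.Im z)).

(* Vectors and matrices indexed by k = -b, ..., b are stored at positions
   0, ..., 2b; [freq b i] is the frequency k = i - b at position i. *)
Definition freq (b : nat) (i : 'I_(2 * b).+1) : int := i%:Z - b%:Z.

Definition trig_poly (R : realType) (b : nat) (c : 'cV[R[i]]_((2 * b).+1))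
    (t : R) : R[i] :=
  \sum_(i < (2 * b).+1) c i 0 * cexp ('i * (2 * pi * (freq i)%:~R * t)%:C).

(* s_b *)
Definition spacing (R : realType) (b : nat) : R := 1 / (2 * b%:R + 1).

(* phi_k, where k = freq i *)
Definition phi (R : realType) (b : nat) (i : 'I_(2 * b).+1) : R[i] :=
  cexp ('i * (2 * pi * (freq i)%:~R * spacing R b)%:C).

Definition Phi (R : realType) (b : nat) : 'M[R[i]]_((2 * b).+1) :=
  \matrix_(l, i) phi R i ^+ l.

(* The r-th smallest (r = 1, ..., n) of x 0, ..., x (n - 1). *)
Definition order_stat (R : realType) (x : nat -> R) (n r : nat) : R :=
  nth 0 (sort <=%R (mkseq x n)) r.-1.

(* x i is the value of U_{i+1}. *)
Definition field_samples (R : realType) (b : nat) (g : R -> R) (n : nat)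
    (x : nat -> R) : 'cV[R[i]]_((2 * b).+1) :=
  \col_l (g (order_stat x n
               (Num.truncn (n%:R * l%:R * spacing R b)).+1))%:C.

Definition coef_estimate (R : realType) (b : nat) (g : R -> R) (n : nat)
    (x : nat -> R) : 'cV[R[i]]_((2 * b).+1) :=
  (1 / (2 * b%:R + 1)) *: ((Phi R b)^t* *m field_samples b g n x).

Definition field_estimate (R : realType) (b : nat) (g : R -> R) (n : nat)
    (x : nat -> R) (t : R) : R[i] :=
  trig_poly (coef_estimate b g n x) t.

Definition mutually_independent (d : measure_display) (T : measurableType d)
    (R : realType) (P : probability T R) (X : nat -> {RV P >-> R}) : Prop :=
  forall (J : seq nat) (A : nat -> set R),
    uniq J -> (forall i, measurable (A i)) ->
    P (\bigcap_(i in [set` J]) (X i @^-1` A i)) =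
    (\prod_(i <- J) P (X i @^-1` A i))%E.

Definition cvg_as (d : measure_display) (T : measurableType d) (R : realType)
    (P : probability T R) (V : topologicalType) (X : nat -> T -> V) (x : V)
    : Prop :=
  {ae P, forall w, X n w @[n --> \oo] --> x}.

(* N is the norm of V. *)
Definition cvg_L2 (d : measure_display) (T : measurableType d) (R : realType)
    (P : probability T R) (V : zmodType) (N : V -> R) (X : nat -> T -> V)
    (x : V) : Prop :=
  ('E_P[fun w => (N (X n w - x) ^+ 2)%R] @[n --> \oo] --> 0)%E.

Definition euclidean_norm (R : realType) (m : nat) (v : 'cV[R[i]]_m) : R :=
  Num.sqrt (\sum_(i < m) Normc.normc (v i 0) ^+ 2).

(* Main.v *)
Require Import Defs.
From mathcomp Require Import all_boot all_order all_algebra.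
From mathcomp Require Import all_classical all_reals all_analysis.
From mathcomp Require Import complex spectral.
From mathcomp Require Import measurable_realfun.
From mathcomp Require Import ring lra zify.
Import Order.TTheory GRing.Theory Num.Theory numFieldNormedType.Exports.
Local Open Scope classical_set_scope.
Local Open Scope ring_scope.
Local Open Scope complex_scope.

(** The law of large numbers, proved from pairwise independence by bounding
    second moments along the squares n = m ^ 2 and interpolating by
    monotonicity of the counts, gives the almost sure convergence of the
    empirical frequency of {U <= q} to q, simultaneously for all rational q.
    As U_{r:n} <= q holds exactly when at least r of the n variables are <= q,
    the order statistic U_{[np]+1:n} converges almost surely to p, for every p
    in [0, 1[; at p = 0 this also needs U >= 0.  So each field sample tends to
    g (l s_b) by continuity of g.  The samples g (l s_b) form the vector
    Phi a, which Phi^* / (2b + 1) maps back to a because the columns of Phi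
    are orthogonal.  The estimation errors are hence fixed linear images of
    the sampling errors, and as |g| <= 1, dominated convergence upgrades
    almost sure convergence to convergence in L^2. *)

(** * Complex exponentials and sums over roots of unity *)

Section Fourier.
Context {R : realType}.
Implicit Types (x y t : R) (b : nat).

Definition cis x : R[i] := cos x +i* sin x.

Lemma cexp_cis x : cexp ('i * x%:C) = cis x.
Proof.
rewrite /cexp /cis; simpc => /=; rewrite ?mul0r ?mul1r ?subr0 ?addr0.
by rewrite ?sub0r ?oppr0 expR0 !mul1r.
Qed.

Lemma cisD x y : cis (x + y) = cis x * cis y.
Proof.
rewrite /cis cosD sinD; simpc; congr (_ +i* _).
by rewrite addrC mulrC [X in _ + X]mulrC.
Qed.

Lemma cis0 : cis 0 = 1. Proof. by rewrite /cis cos0 sin0. Qed.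

Lemma cisX x n : cis x ^+ n = cis (n%:R * x).
Proof.
elim: n => [|n IHn]; first by rewrite mul0r cis0.
by rewrite exprS IHn -cisD -natr1 mulrDl mul1r addrC.
Qed.

Lemma conj_cis x : (cis x)^* = cis (- x).
Proof. by rewrite /cis cosN sinN. Qed.

Lemma cis2piz (m : int) : cis (2 * pi * m%:~R) = 1.
Proof.
have cis2pi : cis (2 * pi) = 1.
  by rewrite /cis mulr_natl cos2pi sin2pi.
have nat_case (n : nat) : cis (2 * pi * n%:R) = 1.
  by rewrite [_ * n%:R]mulrC -cisX cis2pi expr1n.
case: m => n; first exact: nat_case.
by rewrite NegzE intrN mulrN -conj_cis -pmulrn nat_case conjc1.
Qed.

(** One has cos y = 1 - 2 sin^2 (y / 2), with sin (y / 2) > 0 for 0 < y < 2 pi; negative angles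
    follow since cos is even. *)
Lemma cis_neq1 x : 0 < `|x| < 2 * pi -> cis x != 1.
Proof.
move=> /andP[x0 x2]; apply/eqP => -[cosx _].
have pos y : 0 < y -> y < 2 * pi -> cos y != 1.
  move=> y0 y2; have : 0 < sin (y / 2).
    by apply: sin_gt0_pi; apply/andP; split; lra.
  move=> s0; apply/eqP => c1.
  have : cos y = cos (y / 2 + y / 2) by congr cos; lra.
  rewrite cosD c1 -!expr2 cos2sin2 => h.
  have : 0 < sin (y / 2) ^+ 2 by rewrite exprn_gt0.
  by lra.
have := pos `|x| x0 x2.
by case: (ltrP x 0) => h; rewrite ?(ltr0_norm h) ?(ger0_norm h) ?cosN cosx eqxx.
Qed.

Lemma spacing_gt0 b : 0 < spacing R b.
Proof. by rewrite /spacing divr_gt0 // ltr_wpDl // mulr_ge0. Qed.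

Lemma spacing_unit b : (2 * b).+1%:R * spacing R b = 1.
Proof.
by rewrite /spacing -natr1 natrM mul1r divff // gt_eqF.
Qed.

Lemma phiX b (i : 'I_(2 * b).+1) n :
  phi R i ^+ n = cis (2 * pi * (freq i)%:~R * (n%:R * spacing R b)).
Proof. by rewrite /phi cexp_cis cisX; congr cis; ring. Qed.

(** Put z = cis (2 pi m / N), so z^N = 1. For m != 0 the bound |m| < N keeps z away from 1, and z^N
    - 1 = (z - 1) (1 + z + ... + z^(N-1)) forces the sum to vanish. *)
Lemma sum_cis_root (N : nat) (m : int) : (0 < N)%N -> (`|m| < N)%N ->
  \sum_(l < N) cis (2 * pi * (m%:~R / N%:R)) ^+ l = (N * (m == 0))%:R.
Proof.
move=> N0 mN; have [->|m0] := eqVneq m 0.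
  rewrite mul0r mulr0 cis0 muln1.
  by under eq_bigr do rewrite expr1n; rewrite sumr_const card_ord.
have Np : (0 : R) < N%:R by rewrite ltr0n.
set z := cis _.
have zN : z ^+ N = 1.
  by rewrite cisX mulrCA [N%:R * _]mulrC divfK ?gt_eqF // cis2piz.
have z1 : z != 1.
  apply: cis_neq1; rewrite !normrM normfV (ger0_norm (pi_ge0 R)) !normr_nat.
  have p0 : 0 < pi :> R := pi_gt0 R.
  rewrite -intr_norm.
  have m1 : (0 : R) < (`|m|)%:~R by rewrite ltr0z normr_gt0.
  apply/andP; split; first by rewrite !mulr_gt0 // invr_gt0.
  rewrite gtr_pMr ?mulr_gt0 // ltr_pdivrMr // mul1r.
  by rewrite -[N%:R]/(N%:Z%:~R) ltr_int; lia.
have := subrX1 z N; rewrite zN subrr => /esym/eqP; rewrite mulf_eq0 subr_eq0.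
by rewrite (negbTE z1) /= => /eqP ->; rewrite muln0.
Qed.

End Fourier.

(** * Orthogonality of the discrete Fourier matrix *)

Section DiscreteFourierMatrix.
Local Open Scope sesquilinear_scope.

(** Entry (i, k) is a sum of powers of cis (2 pi (k - i) / (2b + 1)), and two frequencies differ by
    at most 2b, so the root-of-unity sum applies. *)
Lemma Phi_orthogonal (R : realType) (b : nat) :
  (Phi R b)^t* *m Phi R b = (2 * b%:R + 1)%:M.
Proof.
apply/matrixP => i k; rewrite !mxE.
(* The adjoint conjugates with [Num.conj], which is convertible to [conjc]. *)
under eq_bigr => l _.
  rewrite !mxE -[Num.conj]/(@conjc R) /phi !cexp_cis !cisX conj_cis -mulrN -!cisX -exprMn -cisD.
  over.
have -> : - (2 * pi * (freq i)%:~R * spacing R b) +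
    2 * pi * (freq k)%:~R * spacing R b =
    2 * pi * ((freq k - freq i)%:~R / (2 * b).+1%:R) :> R.
  have -> : (2 * b).+1%:R^-1 = spacing R b.
    apply: (mulfI (_ : (2 * b).+1%:R != 0)); rewrite ?pnatr_eq0 //.
    by rewrite spacing_unit mulfV ?pnatr_eq0.
  by rewrite intrB; ring.
rewrite sum_cis_root //; last first.
  by rewrite /freq; have := ltn_ord i; have := ltn_ord k; lia.
have -> : (freq k - freq i == 0) = (i == k).
  by rewrite /freq -val_eqE /=; lia.
by case: eqP => _; rewrite ?muln1 ?muln0 // -natr1 natrM.
Qed.

Lemma Phi_trig_poly (R : realType) (b : nat) (a : 'cV[R[i]]_((2 * b).+1))
    (l : 'I_(2 * b).+1) :
  (Phi R b *m a) l 0 = trig_poly a (l%:R * spacing R b).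
Proof.
rewrite mxE /trig_poly; apply: eq_bigr => i _.
by rewrite mxE phiX cexp_cis mulrC.
Qed.

End DiscreteFourierMatrix.

(** * Order statistics and counts for a fixed sequence *)

Section OrderStatistics.
Context {R : realType}.
Implicit Types (x : nat -> R) (p q : R) (n m k : nat).

Definition count_le x q n : nat := (\sum_(i < n) (x i <= q)%R)%N.

Lemma count_mkseq_le x q n : count (<= q) (mkseq x n) = count_le x q n.
Proof.
by rewrite /mkseq count_map -sumn_count sumnE big_map -[n in iota _ n]subn0 big_mkord.
Qed.

Lemma count_le_monotone x q n m : (n <= m)%N -> (count_le x q n <= count_le x q m)%N.
Proof.
by move=> nm; rewrite /count_le -!(big_mkord xpredT (fun i => nat_of_bool (x i <= q)))
  (big_cat_nat _ nm) //= leq_addr.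
Qed.

(** The values at most q form a prefix of the sorted list, and rank [r.+1] reads position r. *)
Lemma order_stat_le x q n r : (r < count_le x q n)%N -> order_stat x n r.+1 <= q.
Proof.
move=> rc; apply: nth_count_le; first exact/sort_sorted/le_total.
by rewrite (permP (permEl (perm_sort _ _))) count_mkseq_le.
Qed.

(** The condition [r < n] keeps the position inside the list, away from the default 0 of [nth]. *)
Lemma order_stat_gt x q n r : (r < n)%N -> (count_le x q n <= r)%N ->
  q < order_stat x n r.+1.
Proof.
move=> rn cr; apply: nth_count_gt; first exact/sort_sorted/le_total.
by rewrite (permP (permEl (perm_sort _ _))) count_mkseq_le size_sort size_mkseq cr.
Qed.

Lemma nat_sqrt_exists n : exists k, (k ^ 2 <= n < k.+1 ^ 2)%N.
Proof.
elim: n => [|n [k /andP[kn nk]]]; first by exists 0%N.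
have [h|h] := ltnP n.+1 (k.+1 ^ 2); [exists k|exists k.+1]; lia.
Qed.

Lemma consecutive_squares p q : 0 <= p < q ->
  \forall m \near \oo, p * (m.+2 ^ 2)%:R <= q * (m.+1 ^ 2)%:R.
Proof.
move=> /andP[p0 pq]; near=> m.
(* As 2m + 3 <= 3 (m + 1), this gives p ((m+2)^2 - (m+1)^2) <= 3 p (m+1) <= (q - p) (m+1)^2. *)
have : 3 * p / (q - p) <= m%:R by near: m; exact: nbhs_infty_ger.
rewrite ler_pdivrMr ?subr_gt0 // !natrX -!natr1.
have : 0 <= m%:R :> R by [].
by nra.
Unshelve. all: by end_near. Qed.

(** The shift to [m.+1] avoids the empty sample. *)
Definition freq_on_squares x q m : R :=
  (count_le x q (m.+1 ^ 2))%:R / (m.+1 ^ 2)%:R.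

(* Between consecutive squares the counts are monotone, and consecutive
   squares are asymptotically equivalent. *)
Lemma count_le_gt_near x p q : 0 <= p < q ->
  freq_on_squares x q m @[m --> \oo] --> q ->
  \forall n \near \oo, n%:R * p < (count_le x q n)%:R.
Proof.
move=> /andP[p0 pq] fq.
(* With p' the midpoint and (m+1)^2 <= n < (m+2)^2, the chain is n p <= p (m+2)^2 <= p' (m+1)^2 <
   count at (m+1)^2 <= count at n. *)
have pp' : 0 <= p < (p + q) / 2 by rewrite p0 midf_lt.
have [M1 _ h1] := consecutive_squares _ _ pp'.
have [M2 _ h2] : \forall m \near \oo, (p + q) / 2 < freq_on_squares x q m.
  by apply: (cvgr_gt q fq); rewrite midf_lt.
near=> n; have [[|m] /andP[kn nk]] := nat_sqrt_exists n.
  suff : (1 ^ 2 <= n)%N by rewrite leqNgt nk.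
  by near: n; exact: nbhs_infty_ge.
(* A large n pushes m past both thresholds. *)
have Mn : (((maxn M1 M2).+2) ^ 2 <= n)%N by near: n; exact: nbhs_infty_ge.
have Mm : (maxn M1 M2 <= m)%N.
  by have := leq_ltn_trans Mn nk; rewrite ltn_sqr; lia.
have {}h1 := h1 m (leq_trans (leq_maxl _ _) Mm).
have := h2 m (leq_trans (leq_maxr _ _) Mm).
rewrite /= /freq_on_squares ltr_pdivlMr ?ltr0n ?expn_gt0 //= => h.
apply: (@le_lt_trans _ _ (p * (m.+2 ^ 2)%:R)).
  by rewrite mulrC ler_wpM2l // ler_nat ltnW.
apply: le_lt_trans h1 _; apply: lt_le_trans h _.
by rewrite ler_nat count_le_monotone.
Unshelve. all: by end_near. Qed.

(** The mirror chain, with p' the midpoint: count at n <= count at (m+2)^2 < p' (m+2)^2 <= p (m+1)^2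
    <= p n. *)
Lemma count_le_lt_near x p q : 0 <= q < p ->
  freq_on_squares x q m @[m --> \oo] --> q ->
  \forall n \near \oo, (count_le x q n)%:R < n%:R * p.
Proof.
move=> /andP[q0 qp] fq.
have pp' : 0 <= (q + p) / 2 < p.
  by rewrite midf_lt // divr_ge0 // addr_ge0 // (le_trans q0) // ltW.
have [M1 _ h1] := consecutive_squares _ _ pp'.
have [M2 _ h2] : \forall m \near \oo, freq_on_squares x q m < (q + p) / 2.
  by apply: (cvgr_lt q fq); rewrite midf_lt.
near=> n; have [[|m] /andP[kn nk]] := nat_sqrt_exists n.
  suff : (1 ^ 2 <= n)%N by rewrite leqNgt nk.
  by near: n; exact: nbhs_infty_ge.
have Mn : (((maxn M1 M2).+2) ^ 2 <= n)%N by near: n; exact: nbhs_infty_ge.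
have Mm : (maxn M1 M2 <= m)%N.
  by have := leq_ltn_trans Mn nk; rewrite ltn_sqr; lia.
have {}h1 := h1 m (leq_trans (leq_maxl _ _) Mm).
(* Index [m.+1] selects the square above n. *)
have := h2 m.+1 (leqW (leq_trans (leq_maxr _ _) Mm)).
rewrite /= /freq_on_squares ltr_pdivrMr ?ltr0n ?expn_gt0 //= => h.
apply: (@lt_le_trans _ _ (p * (m.+1 ^ 2)%:R)); last first.
  by rewrite mulrC ler_wpM2r ?ler_nat // (le_trans q0) // ltW.
apply: lt_le_trans h1; apply: le_lt_trans h.
by rewrite ler_nat count_le_monotone // ltnW.
Unshelve. all: by end_near. Qed.

(** For rational r slightly above p, eventually more than [np] values are at most r; for r slightly
    below p, eventually at most [np] are. This traps the order statistic. *)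
Lemma order_stat_cvg x p : 0 <= p < 1 -> (forall i, 0 <= x i) ->
  (forall q : rat, 0 <= (ratr q : R) <= 1 ->
    freq_on_squares x (ratr q) m @[m --> \oo] --> (ratr q : R)) ->
  order_stat x n (Num.truncn (n%:R * p)).+1 @[n --> \oo] --> p.
Proof.
move=> /andP[p0 p1] x0 fx; apply/cvgrPdist_lt => e e0.
have np0 n : 0 <= n%:R * p by rewrite mulr_ge0.
have rank_lt n : (0 < n)%N -> (Num.truncn (n%:R * p) < n)%N.
  by move=> n0; rewrite truncn_lt_nat // gtr_pMr // ltr0n.
have above : \forall n \near \oo,
    order_stat x n (Num.truncn (n%:R * p)).+1 < p + e.
  (* The rational stays below 1, since frequencies are controlled only at rationals of [0, 1]. *)
  have /rat_in_itvoo[r] : p < Num.min 1 (p + e) by rewrite lt_min p1 ltrDl.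
  rewrite in_itv /= lt_min => /andP[pr /andP[r1 re]].
  have r01 : 0 <= (ratr r : R) <= 1 by rewrite (ltW r1) (le_trans p0) // ltW.
  have pr' : 0 <= p < ratr r by rewrite p0.
  apply: filterS (count_le_gt_near _ _ _ pr' (fx r r01)) => n h.
  apply: le_lt_trans re; apply: order_stat_le.
  by rewrite truncn_lt_nat.
have below : \forall n \near \oo,
    p - e < order_stat x n (Num.truncn (n%:R * p)).+1.
  have [p_gt0|] := ltP 0 p; last first.
    (* Here p = 0, so p - e < 0 and nonnegativity makes the count vanish. *)
    move=> p_le0; near=> n.
    have n0 : (0 < n)%N by near: n; exact: nbhs_infty_gt.
    apply: order_stat_gt; first exact: rank_lt.
    rewrite /count_le big1 // => i _; apply/eqP; rewrite eqb0 -ltNge.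
    by apply: lt_le_trans (x0 i); lra.
  have /rat_in_itvoo[r] : Num.max 0 (p - e) < p by rewrite gt_max p_gt0 gtrBl.
  rewrite in_itv /= gt_max => /andP[/andP[r0 re] rp].
  have r01 : 0 <= (ratr r : R) <= 1 by rewrite (ltW r0) /= ltW // (lt_trans rp).
  have rp' : 0 <= (ratr r : R) < p by rewrite (ltW r0).
  near=> n; apply: lt_trans re _.
  have n0 : (0 < n)%N by near: n; exact: nbhs_infty_gt.
  apply: order_stat_gt; first exact: rank_lt.
  rewrite truncn_ge_nat // ltW //; near: n.
  exact: count_le_lt_near _ _ _ rp' (fx r r01).
near=> n; rewrite ltr_distlC; apply/andP; split; near: n => //.
Unshelve. all: by end_near. Qed.

End OrderStatistics.

(** * Law of large numbers along the squares *)

Lemma sum_inv_squares_le (R : realType) n :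
  \sum_(0 <= m < n) ((m.+1 ^ 2)%:R)^-1 <= 2 :> R.
Proof.
(* The sharper bound is inductive because 1/x - 1/(x+1) - 1/(x+1)^2 = 1/(x (x+1)^2) >= 0. *)
suff h k : \sum_(0 <= m < k.+1) ((m.+1 ^ 2)%:R)^-1 <= 2 - (k.+1%:R)^-1 :> R.
  case: n => [|n]; first by rewrite big_geq.
  by apply: le_trans (h n) _; rewrite gerBl invr_ge0.
elim: k => [|k IHk]; first by rewrite big_nat1 exp1n invr1; lra.
rewrite big_nat_recr //=; apply: le_trans (lerD IHk (lexx _)) _.
have k0 : (0 : R) < k.+1%:R by rewrite ltr0n.
rewrite natrX -[k.+2%:R]natr1; move: k0; set x := k.+1%:R => x0.
rewrite -subr_ge0.
have -> : 2 - (x + 1)^-1 - (2 - x^-1 + ((x + 1) ^+ 2)^-1) = (x * (x + 1) ^+ 2)^-1.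
  by field; apply/andP; split; lra.
by rewrite invr_ge0 mulr_ge0 ?sqr_ge0 // ltW.
Qed.

Section LawOfLargeNumbers.
Context {d : measure_display} {T : measurableType d} {R : realType}.
Variable P : probability T R.
Variables (E : nat -> set T) (q : R).
Hypothesis mE : forall i, measurable (E i).
Hypothesis PE : forall i, P (E i) = q%:E.
Hypothesis PEE : forall i j, i != j -> P (E i `&` E j) = (q ^+ 2)%:E.

(** These are the variance and the covariances of Bernoulli indicators; pairwise independence makes
    the latter vanish. *)
Lemma integral_centered_product i j :
  (\int[P]_w ((\1_(E i) w - q) * (\1_(E j) w - q))%:E =
   (if i == j then q - q ^+ 2 else 0)%:E)%E.
Proof.
transitivity (\int[P]_w ((\1_(E i `&` E j) w)%:E + ((- q)%:E * (\1_(E i) w)%:E +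
    ((- q)%:E * (\1_(E j) w)%:E + (cst (q ^+ 2) w)%:E))))%E.
  apply: eq_integral => w _; rewrite indicI /= -!EFinM -!EFinD; congr (_%:E).
  by ring.
have mEE : measurable (E i `&` E j) by exact: measurableI.
have cI := finite_measure_integrable_cst P (q ^+ 2) measurableT.
have eI A : measurable A -> P.-integrable setT (fun w => (\1_A w)%:E).
  by move=> mA; exact: integrable_indic.
have zI A k : measurable A -> P.-integrable setT (fun w => k%:E * (\1_A w)%:E)%E.
  by move=> mA; apply: integrableZl => //; exact: eI.
have jI := integrableD measurableT (zI _ (- q) (mE j)) cI.
rewrite integralD //=; last 2 first.
- exact: eI.
- by apply: (integrableD measurableT (zI _ (- q) (mE i)) jI).
rewrite integralD //=; last exact: zI.
rewrite integralD //=; last exact: zI.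
rewrite !integralZl ?integral_indic ?setIT ?integral_cst //; try exact: eI.
rewrite /= probability_setT mule1 !PE -!EFinM -!EFinD.
case: eqVneq => [->|ij]; first by rewrite setIid PE -EFinD; congr (_%:E); ring.
by rewrite PEE // -EFinD; congr (_%:E); ring.
Qed.

(** Once the square is expanded, only the n diagonal terms survive. *)
Lemma second_moment_sum_indic n :
  (\int[P]_w ((\sum_(i < n) \1_(E i) w - n%:R * q) ^+ 2)%:E =
   (n%:R * (q - q ^+ 2))%:E)%E.
Proof.
transitivity (\int[P]_w (\sum_(i < n) \sum_(j < n)
    ((\1_(E i) w - q) * (\1_(E j) w - q))%:E))%E.
  apply: eq_integral => w _.
  have -> : \sum_(i < n) \1_(E i) w - n%:R * q = \sum_(i < n) (\1_(E i) w - q).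
    by rewrite sumrB sumr_const card_ord mulr_natl.
  rewrite expr2 mulr_suml -sumEFin; apply: eq_bigr => i _.
  by rewrite mulr_sumr -sumEFin.
have bI i j : P.-integrable setT
    (EFin \o (fun w => (\1_(E i) w - q) * (\1_(E j) w - q))).
  apply: measurable_bounded_integrable => //.
  - by rewrite (le_lt_trans (probability_le1 _ _)) ?ltry.
  - by apply: measurable_funM; apply: measurable_funB => //; exact: measurable_indic.
  - exists ((1 + `|q|) * (1 + `|q|)); split; first exact: num_real.
    move=> M hM w _ /=; apply: le_trans (ltW hM); rewrite normrM.
    have ind A : `|\1_A w - q| <= 1 + `|q|.
      apply: le_trans (ler_normB _ _) _; rewrite lerD2r indicE.
      by case: (_ \in _); rewrite ?normr1 ?normr0.
    by rewrite ler_pM.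
rewrite integral_sum //; last first.
  move=> i; exact: (@integrable_sum _ _ _ P setT measurableT _ _ xpredT _
    (fun j _ => bI i (nat_of_ord j))).
rewrite (eq_bigr (fun=> (q - q ^+ 2)%:E)) => [|i _].
  by rewrite sumEFin sumr_const card_ord mulr_natl.
rewrite integral_sum //; last by move=> j; exact: bI.
under eq_bigr do rewrite integral_centered_product.
rewrite (bigD1 i) //= eqxx big1 ?adde0 // => j ji.
by rewrite val_eqE eq_sym (negbTE ji).
Qed.

(* The second moments of the centred averages are summable along the squares,
   but not along all integers. *)
Lemma lln_on_squares :
  {ae P, forall w,
    (\sum_(i < m.+1 ^ 2) \1_(E i) w) / (m.+1 ^ 2)%:R @[m --> \oo] --> q}.
Proof.
pose f m w : R := ((\sum_(i < m.+1 ^ 2) \1_(E i) w) / (m.+1 ^ 2)%:R - q) ^+ 2.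
have mf m : measurable_fun setT (f m).
  apply: measurable_funX; apply: measurable_funB => //.
  apply: measurable_funM => //; apply: measurable_sum => i.
  exact: measurable_indic.
have f_int m : (\int[P]_w (f m w)%:E <= (((m.+1 ^ 2)%:R)^-1)%:E)%E.
  have c0 : (0 : R) < (m.+1 ^ 2)%:R by rewrite ltr0n expn_gt0.
  set c := (m.+1 ^ 2)%:R in c0 *.
  have -> : (\int[P]_w (f m w)%:E = (c ^- 2)%:E * \int[P]_w
      ((\sum_(i < m.+1 ^ 2) \1_(E i) w - c * q) ^+ 2)%:E)%E.
    rewrite -ge0_integralZl //=.
    - apply: eq_integral => w _; rewrite -EFinM; congr (_%:E).
      by rewrite /f -/c; move: (c) c0 => k k0; field; rewrite lt0r_neq0.
    - apply/measurable_EFinP; apply: measurable_funX; apply: measurable_funB => //.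
      by apply: measurable_sum => i; exact: measurable_indic.
    - by move=> w _; rewrite lee_fin sqr_ge0.
    - by rewrite lee_fin invr_ge0 sqr_ge0.
  rewrite second_moment_sum_indic -EFinM lee_fin.
  have -> : c ^- 2 * (c * (q - q ^+ 2)) = c^-1 * (q - q ^+ 2).
    by move: (c) c0 => k k0; field; rewrite lt0r_neq0.
  rewrite ler_piMr ?invr_ge0 ?ltW //.
  by have := sqr_ge0 (q - 1); nra.
(* Sum and integral are exchanged for nonnegative terms, leaving the convergent series of inverse
   squares as a bound. *)
have fs : (\int[P]_w (\sum_(0 <= m <oo) (f m w)%:E) < +oo)%E.
  rewrite integral_nneseries //; last 2 first.
  - by move=> m; apply/measurable_EFinP.
  - by move=> m w _; rewrite lee_fin sqr_ge0.
  apply: (@le_lt_trans _ _ 2%:E); last exact: ltry.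
  apply: lime_le.
    apply: is_cvg_nneseries => m _ _.
    by apply: integral_ge0 => w _; rewrite lee_fin sqr_ge0.
  near=> n; apply: (@le_trans _ _ (\sum_(0 <= m < n) (((m.+1 ^ 2)%:R)^-1)%:E)%E).
    exact: lee_sum.
  by rewrite sumEFin lee_fin sum_inv_squares_le.
have s0 w : (0 <= \sum_(0 <= m <oo) (f m w)%:E)%E.
  by apply: nneseries_ge0 => m _ _; rewrite lee_fin sqr_ge0.
have fI : P.-integrable setT (fun w => \sum_(0 <= m <oo) (f m w)%:E)%E.
  apply/integrableP; split.
    by apply: ge0_emeasurable_sum => [m w _ _|m _]; [rewrite lee_fin sqr_ge0|apply/measurable_EFinP].
  by under eq_integral do rewrite gee0_abs //.
(* An integrable function is finite almost everywhere; where the series of squared deviations is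
   finite, its terms tend to 0. *)
apply: filterS (integrable_ae measurableT fI) => w /(_ I) fw.
have : f m w @[m --> \oo] --> 0.
  apply: cvg_series_cvg_0; apply: nnseries_is_cvg => [m|]; first exact: sqr_ge0.
  by rewrite -ge0_fin_numE.
move=> /cvgrPdist_lt h; apply/cvgrPdist_lt => e e0.
have e2 : 0 < e ^+ 2 by rewrite exprn_gt0.
near=> m; have : `|0 - f m w| < e ^+ 2 by near: m; exact: h.
rewrite sub0r normrN ger0_norm ?sqr_ge0 // distrC /f -[X in X ^+ 2 < _]/(_ - _).
by rewrite -real_normK ?num_real // ltr_pXn2r ?nnegrE // ltW.
Unshelve. all: by end_near. Qed.

End LawOfLargeNumbers.

(** * Almost sure convergence of uniform sample quantiles *)

Section SampleQuantiles.
Context {d : measure_display} {T : measurableType d} {R : realType}.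
Variables (P : probability T R) (U : nat -> {RV P >-> R}).

Lemma mutually_independentE i j (A B : set R) : mutually_independent U ->
  i != j -> measurable A -> measurable B ->
  P (U i @^-1` A `&` U j @^-1` B) = (P (U i @^-1` A) * P (U j @^-1` B))%E.
Proof.
move=> ind ij mA mB.
(* Only the values at i and j matter; elsewhere any measurable set will do. *)
pose F k := if k == i then A else B.
have := ind [:: i; j] F _ _; rewrite big_cons big_seq1 /F eqxx eq_sym (negbTE ij).
rewrite /= inE ij => <- //; last by move=> k; case: ifP.
congr (P _); apply/seteqP; split => w /=.
  move=> [Aw Bw] k /=; rewrite !inE => /orP[]/eqP->; first by rewrite eqxx.
  by rewrite eq_sym (negbTE ij).
move=> h; split; first by have := h i; rewrite /= !inE !eqxx; apply.
by have := h j; rewrite /= !inE !eqxx orbT eq_sym (negbTE ij); apply.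
Qed.

(** Open upper rays generate the Borel sets, and an order statistic exceeds q exactly when a count,
    a finite sum of measurable indicators, is small enough. *)
Lemma measurable_order_stat n r :
  measurable_fun setT (fun w => order_stat (fun i => U i w) n r).
Proof.
(* Past the end of the list the default of [nth] makes the function constant. *)
have [rn|nr] := ltnP r.-1 n; last first.
  rewrite (_ : (fun w => _) = cst 0) //; apply/funext => w.
  by rewrite /order_stat nth_default // size_sort size_mkseq.
apply: (measurability (@RGenOInfty.G R)) => [|/= _ [_] [q] -> <-].
  exact: RGenOInfty.measurableE.
rewrite setTI (_ : _ @^-1` _ =
    (fun w => count_le (fun i => U i w) q n <= r.-1)%N @^-1` [set true]); last first.
  apply/seteqP; split => w /=; rewrite in_itv /= andbT.
    by move=> qo; rewrite leqNgt; apply/negP => /order_stat_le; rewrite leNgt qo.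
  by move=> c; exact: order_stat_gt.
have m_nat_of_bool : measurable_fun setT nat_of_bool by [].
rewrite -[X in measurable X]setTI.
apply: measurable_fun_leq => //.
rewrite /count_le.
elim: n {rn} => [|n IHn].
  by rewrite (_ : (fun w => _) = cst 0%N) //; apply/funext => w; rewrite big_ord0.
rewrite (_ : (fun w => _) = fun w => (\sum_(i < n) (U i w <= q)%R + (U n w <= q)%R)%N).
  apply: measurable_fun_addn => //; apply: (measurableT_comp m_nat_of_bool).
  exact: measurable_fun_ler.
by apply/funext => w; rewrite big_ord_recr.
Qed.

Hypothesis indU : mutually_independent U.
Hypothesis unifU : forall i A, measurable A ->
  distribution P (U i) A = uniform_prob (@ltr01 R) A.

Lemma uniform_cdf i q : 0 <= q <= 1 -> P (U i @^-1` `]-oo, q]) = q%:E.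
Proof.
move=> /andP[q0 q1]; rewrite -[LHS]/(distribution P (U i) _) unifU //.
rewrite /uniform_prob integral_uniform_pdf.
have -> : `]-oo, q] `&` `[0, 1] = `[0, q]%classic :> set R.
  by apply/seteqP; split => x /=; rewrite !in_itv /=; lra.
rewrite (eq_integral (cst 1%E)) => [|x]; last first.
  rewrite inE /= in_itv /= /uniform_pdf => /andP[x0 xq].
  by rewrite x0 (le_trans xq q1) subr0 invr1.
rewrite integral_cst // mul1e.
rewrite /= lebesgue_measure_itv /= lte_fin.
by case: ltgtP q0 => //= [_ _|<- _]; rewrite ?oppr0 ?adde0.
Qed.

Lemma uniform_ge0 : {ae P, forall w, forall i, 0 <= U i w}.
Proof.
apply: ae_foralln => i; exists (U i @^-1` `]-oo, 0[); split.
- by rewrite -[X in measurable X]setTI; exact: measurable_funPT.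
- rewrite -[LHS]/(distribution P (U i) _) unifU // /uniform_prob integral_uniform_pdf.
  have -> : `]-oo, 0[ `&` `[0, 1] = set0 :> set R.
    by apply/seteqP; split => x //=; rewrite !in_itv /=; lra.
  by rewrite integral_set0.
- by move=> w /= /negP; rewrite -ltNge in_itv.
Qed.

Lemma freq_on_squares_cvg_as q : 0 <= q <= 1 ->
  {ae P, forall w,
    freq_on_squares (fun i => U i w) q m @[m --> \oo] --> q}.
Proof.
move=> q01; pose E i := U i @^-1` `]-oo, q].
have mE i : measurable (E i).
  by rewrite /E -[X in measurable X]setTI; exact: measurable_funPT.
have PE i : P (E i) = q%:E by exact: uniform_cdf.
have PEE i j : i != j -> P (E i `&` E j) = (q ^+ 2)%:E.
  by move=> ij; rewrite mutually_independentE // !uniform_cdf.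
apply: filterS (lln_on_squares P E q mE PE PEE) => w.
apply: cvg_trans; apply: near_eq_cvg; near=> m.
rewrite /freq_on_squares /count_le natr_sum; congr (_ / _); apply: eq_bigr => i _.
rewrite indicE /E; congr (_%:R); congr nat_of_bool.
by apply/idP/idP; rewrite inE /= in_itv.
Unshelve. all: by end_near. Qed.

(** A single null set serves all p, because only countably many frequencies enter. *)
Lemma sample_quantile_cvg_as : {ae P, forall w, forall p : R, 0 <= p < 1 ->
  order_stat (fun i => U i w) n (Num.truncn (n%:R * p)).+1 @[n --> \oo] --> p}.
Proof.
(* Rationals are enumerated through [unpickle]; codes of no rational, or of one outside [0, 1], give
   vacuous statements. *)
have ratU : {ae P, forall w, forall k : nat, forall q : rat, unpickle k = Some q ->
    0 <= (ratr q : R) <= 1 ->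
    freq_on_squares (fun i => U i w) (ratr q) m @[m --> \oo] --> (ratr q : R)}.
  apply: ae_foralln => k; case E : (unpickle k) => [q|]; last by apply: aeW.
  have [q01|q01] := boolP (0 <= (ratr q : R) <= 1).
    by apply: filterS (freq_on_squares_cvg_as _ q01) => w h _ [<-] _.
  by apply: aeW => w _ [<-]; rewrite (negbTE q01).
apply: filterS2 ratU uniform_ge0 => w hq hU p p01.
apply: order_stat_cvg => // q q01.
exact: (hq (pickle q) q (pickleK q) q01).
Qed.

End SampleQuantiles.

(** * Norms, convergence and continuity over the complex numbers *)

Section ComplexVectors.
Context {R : realType}.

Lemma normc_sqr (z : R[i]) :
  Normc.normc z ^+ 2 = complex.Re z ^+ 2 + complex.Im z ^+ 2.
Proof. by case: z => x y /=; rewrite sqr_sqrtr // addr_ge0 ?sqr_ge0. Qed.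

Lemma euclidean_norm_sqr m (v : 'cV[R[i]]_m) :
  euclidean_norm v ^+ 2 = \sum_(i < m) Normc.normc (v i 0) ^+ 2.
Proof. by rewrite sqr_sqrtr // sumr_ge0 // => i _; rewrite sqr_ge0. Qed.

Lemma euclidean_norm_sqr1 (v : 'cV[R[i]]_1) :
  euclidean_norm v ^+ 2 = Normc.normc (v 0 0) ^+ 2.
Proof. by rewrite euclidean_norm_sqr big_ord1. Qed.

Lemma Re_sum (I : Type) (r : seq I) (F : I -> R[i]) :
  complex.Re (\sum_(i <- r) F i) = \sum_(i <- r) complex.Re (F i).
Proof. by apply: (big_morph (@complex.Re R)) => // -[? ?] [? ?]. Qed.

Lemma Im_sum (I : Type) (r : seq I) (F : I -> R[i]) :
  complex.Im (\sum_(i <- r) F i) = \sum_(i <- r) complex.Im (F i).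
Proof. by apply: (big_morph (@complex.Im R)) => // -[? ?] [? ?]. Qed.

(** For real x the real and imaginary parts of C act separately, which reduces limits and
    measurability to real sums. *)
Lemma euclidean_norm_sqr_mulmx m N (C : 'M[R[i]]_(m, N)) (x : 'I_N -> R) :
  euclidean_norm (C *m \col_l (x l)%:C) ^+ 2 =
  \sum_(i < m) ((\sum_(l < N) complex.Re (C i l) * x l) ^+ 2 +
                (\sum_(l < N) complex.Im (C i l) * x l) ^+ 2).
Proof.
rewrite euclidean_norm_sqr; apply: eq_bigr => i _.
rewrite normc_sqr mxE Re_sum Im_sum; congr (_ ^+ 2 + _ ^+ 2);
  apply: eq_bigr => l _; rewrite mxE; case: (C i l) => u v /=.
  by rewrite mulr0 subr0.
by rewrite mulr0 add0r.
Qed.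

Lemma near_norm_lt (z : nat -> R[i]) (e : R[i]) : 0 < e ->
  Normc.normc (z n) ^+ 2 @[n --> \oo] --> 0 ->
  \forall n \near \oo, `|z n| < e.
Proof.
(* A positive element of [R[i]] has zero imaginary part, so the radius is a real r. *)
case: e => r s; rewrite ltcE /= => /andP[/eqP-> r0] z0.
have r2 : 0 < r ^+ 2 by rewrite exprn_gt0.
near=> n; have : Normc.normc (z n) ^+ 2 < r ^+ 2.
  by near: n; exact: cvgr_lt z0 _ r2.
rewrite -[`|z n|]/(Normc.normc (z n))%:C complexr0 ltcR.
by rewrite ltr_pXn2r // nnegrE ?(ltW r0) //; case: (z n) => u v; exact: sqrtr_ge0.
Unshelve. all: by end_near. Qed.

Lemma cvg_complex (z : nat -> R[i]) (x : R[i]) :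
  Normc.normc (z n - x) ^+ 2 @[n --> \oo] --> 0 ->
  (z : nat -> R[i]^o) n @[n --> \oo] --> (x : R[i]^o).
Proof.
move=> zx; apply/cvgrPdist_lt => e e0.
apply: filterS (near_norm_lt _ _ e0 zx) => n; by rewrite distrC.
Qed.

(** Balls of matrices are entrywise; each entry is bounded by the Euclidean norm, and there are
    finitely many. *)
Lemma cvg_complex_col m (v : nat -> 'cV[R[i]]_m) (a : 'cV[R[i]]_m) :
  euclidean_norm (v n - a) ^+ 2 @[n --> \oo] --> 0 ->
  (v : nat -> 'cV[R[i]^o]_m) n @[n --> \oo] --> (a : 'cV[R[i]^o]_m).
Proof.
move=> va; apply/cvg_ballP => e e0.
have entry i : \forall n \near \oo, `|(v n - a) i 0| < e.
  apply: near_norm_lt e0 _.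
  apply: (squeeze_cvgr _ (cvg_cst 0) va); near=> n.
  rewrite sqr_ge0 euclidean_norm_sqr (bigD1 i) //= lerDl.
  by rewrite sumr_ge0 // => j _; rewrite sqr_ge0.
near=> n; split=> // i j.
have h : forall i, `|(v n - a) i 0| < e by near: n; exact: (filter_forall _ entry).
by rewrite -ball_normE /= distrC; have := h i; rewrite !mxE ord1.
Unshelve. all: by end_near. Qed.

Lemma continuous_Re_trig_poly b (a : 'cV[R[i]]_((2 * b).+1)) :
  continuous (fun t => complex.Re (trig_poly a t)).
Proof.
rewrite (_ : (fun t => _) = fun t => \sum_(i < (2 * b).+1)
    (complex.Re (a i 0) * cos (2 * pi * (freq i)%:~R * t) -
     complex.Im (a i 0) * sin (2 * pi * (freq i)%:~R * t))); last first.
  apply/funext => t; rewrite Re_sum; apply: eq_bigr => i _.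
  by rewrite cexp_cis; case: (a i 0).
apply: continuous_big => // [|i _ t]; first exact: add_continuous.
have lin : {for t, continuous (fun t => 2 * pi * (freq i)%:~R * t)}.
  by apply: cvgMl_tmp.
apply: cvgB; apply: cvgMl_tmp.
  exact: (continuous_comp lin (@continuous_cos R _)).
exact: (continuous_comp lin (@continuous_sin R _)).
Qed.

End ComplexVectors.

(** * Fixed linear images of bounded errors tending to 0 *)

Lemma cvg_sum0 {R : realType} {I : Type} (r : seq I) (f : I -> nat -> R) :
  (forall i, f i n @[n --> \oo] --> 0) -> \sum_(i <- r) f i n @[n --> \oo] --> 0.
Proof.
move=> f0; have := @cvg_big R I +%R 0 xpredT add_continuous nat \oo r f (fun=> 0) _
  (fun i _ => f0 i).
have -> : \sum_(i <- r) (fun=> 0) i = 0 :> R by rewrite big1.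
exact.
Qed.

Section LinearImage.
Context {d : measure_display} {T : measurableType d} {R : realType}.
Variables (P : probability T R) (m N : nat) (C : 'M[R[i]]_(m, N)).
Variables (D : nat -> T -> 'I_N -> R) (K : R).
Hypothesis mD : forall n l, measurable_fun setT (fun w => D n w l).
Hypothesis D_le : forall n w l, `|D n w l| <= K.
Hypothesis D_cvg0 : {ae P, forall w, forall l, D n w l @[n --> \oo] --> 0}.

Let Z n w := C *m \col_l (D n w l)%:C.

Lemma linear_image_cvg_as :
  {ae P, forall w, euclidean_norm (Z n w) ^+ 2 @[n --> \oo] --> 0}.
Proof.
apply: filterS D_cvg0 => w D0; rewrite /Z.
under eq_fun do rewrite euclidean_norm_sqr_mulmx.
have sum_cvg0 (c : 'I_N -> R) :
    (\sum_(l < N) c l * D n w l) ^+ 2 @[n --> \oo] --> 0.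
  have h : \sum_(l < N) c l * D n w l @[n --> \oo] --> 0.
    apply: cvg_sum0 => l; have := cvgMl_tmp (a := c l) (D0 l).
    by rewrite mulr0; apply.
  by have := cvgM h h; rewrite mulr0; apply.
apply: cvg_sum0 => i.
have := cvgD (sum_cvg0 (fun l => complex.Re (C i l))) (sum_cvg0 (fun l => complex.Im (C i l))).
by rewrite addr0; apply.
Qed.

Lemma linear_image_cvg_L2 :
  ('E_P[fun w => (euclidean_norm (Z n w) ^+ 2)%R] @[n --> \oo] --> 0)%E.
Proof.
rewrite expectation.unlock.
pose f n w := (euclidean_norm (Z n w) ^+ 2)%:E.
(* The dominating constant: each error is replaced by its bound K and each coefficient by its
   absolute value. *)
pose B := \sum_(i < m) ((\sum_(l < N) `|complex.Re (C i l)| * K) ^+ 2 +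
                (\sum_(l < N) `|complex.Im (C i l)| * K) ^+ 2).
have sum_le n w (c : 'I_N -> R) :
    (\sum_(l < N) c l * D n w l) ^+ 2 <= (\sum_(l < N) `|c l| * K) ^+ 2.
  rewrite -real_normK ?num_real // lerXn2r ?nnegrE //.
    (* K >= 0 because it bounds an absolute value. *)
    by apply: sumr_ge0 => l _; rewrite mulr_ge0 // (le_trans _ (D_le n w l)).
  apply: le_trans (ler_norm_sum _ _ _) _; apply: ler_sum => l _.
  by rewrite normrM ler_wpM2l.
have mf n : measurable_fun setT (f n).
  apply/measurable_EFinP; rewrite /Z.
  under eq_fun do rewrite euclidean_norm_sqr_mulmx.
  apply: measurable_sum => i; apply: measurable_funD; apply: measurable_funX;
    by apply: measurable_sum => l; apply: measurable_funM.
have f0 : {ae P, forall w, setT w -> f n w @[n --> \oo] --> (cst 0%E : T -> \bar R) w}.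
  apply: filterS linear_image_cvg_as => w h _.
  exact: (cvg_comp _ _ h).
have fB : {ae P, forall w n, setT w -> (`|f n w| <= cst B%:E w)%E}.
  apply: aeW => w n _ /=; rewrite lee_fin ger0_norm ?sqr_ge0 //.
  by rewrite euclidean_norm_sqr_mulmx; apply: ler_sum => i _; exact: lerD.
have [_ _] := dominated_convergence measurableT mf (measurable_cst _) f0
  (finite_measure_integrable_cst P B measurableT) fB.
by rewrite integral_cst // mul0e.
Qed.

End LinearImage.

(** * Estimation errors as linear images of sampling errors *)

Section Reconstruction.
Local Open Scope sesquilinear_scope.
Context {R : realType} {b : nat}.
Variables (a : 'cV[R[i]]_((2 * b).+1)) (g : R -> R).
Hypothesis gE : forall t, (g t)%:C = trig_poly a t.

(** The product is bracketed so that the rank reads [np] + 1 with p = l s_b. *)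
Definition sampling_error (x : nat -> R) (n : nat) (l : 'I_(2 * b).+1) : R :=
  g (order_stat x n (Num.truncn (n%:R * (l%:R * spacing R b))).+1) -
  g (l%:R * spacing R b).

(** A left inverse of [Phi R b], by [Phi_orthogonal]. *)
Definition reconstruction_matrix : 'M[R[i]]_((2 * b).+1) :=
  (1 / (2 * b%:R + 1)) *: (Phi R b)^t*.

Definition fourier_row (t : R) : 'rV[R[i]]_((2 * b).+1) :=
  \row_i cexp ('i * (2 * pi * (freq i)%:~R * t)%:C).

(** The samples are the errors plus Phi a, and the left inverse returns a from the second term. *)
Lemma coef_estimate_error n x : coef_estimate b g n x - a =
  reconstruction_matrix *m \col_l (sampling_error x n l)%:C.
Proof.
have samplesE : field_samples b g n x =
    \col_l (sampling_error x n l)%:C + Phi R b *m a.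
  apply/matrixP => l j; rewrite ord1 [RHS]mxE Phi_trig_poly -gE !mxE.
  by rewrite -mulrA rmorphB /= subrK.
have N0 : 2 * b%:R + 1 != 0 :> R[i].
  by rewrite -natrM natr1 pnatr_eq0.
rewrite /coef_estimate samplesE mulmxDr mulmxA Phi_orthogonal scalerDr.
rewrite mul_scalar_mx scalerA div1r mulVf // scale1r addrK.
by rewrite /reconstruction_matrix -scalemxAl div1r.
Qed.

(** Evaluation at t is multiplication by a fixed row, so the scalar error is a one-row linear
    image. *)
Lemma field_estimate_error n x t : field_estimate b g n x t - (g t)%:C =
  ((fourier_row t *m reconstruction_matrix) *m
     \col_l (sampling_error x n l)%:C) 0 0.
Proof.
have trig_polyE c : trig_poly c t = (fourier_row t *m c) 0 0.
  by rewrite mxE; apply: eq_bigr => i _; rewrite mxE mulrC.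
rewrite gE /field_estimate !trig_polyE -mulmxA -coef_estimate_error mulmxBr.
by rewrite [RHS]mxE [X in _ = _ + X]mxE.
Qed.

Lemma field_continuous : continuous g.
Proof.
rewrite (_ : g = fun t => complex.Re (trig_poly a t)).
  exact: continuous_Re_trig_poly.
by apply/funext => t; rewrite -gE.
Qed.

End Reconstruction.

(* R[i] carries its norm topology only under the alias R[i]^o. *)
Theorem mainTheorem2 (R : realType) (d : measure_display)
    (T : measurableType d) (P : probability T R)
    (b : nat) (a : 'cV[R[i]]_((2 * b).+1)) (g : R -> R)
    (U : nat -> {RV P >-> R}) :
  (1 <= b)%N ->
  (forall t : R, (g t)%:C = trig_poly a t) ->
  (forall t : R, `|g t| <= 1) ->
  mutually_independent U ->
  (forall (i : nat) (A : set R), measurable A ->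
     distribution P (U i) A = uniform_prob (@ltr01 R) A) ->
  let A (n : nat) (w : T) := coef_estimate b g n (fun i => U i w) in
  let G (t : R) (n : nat) (w : T) :=
    field_estimate b g n (fun i => U i w) t in
  [/\ cvg_as P (A : nat -> T -> 'cV[R[i]^o]_((2 * b).+1)) a,
      cvg_L2 P (@euclidean_norm R (2 * b).+1) A a &
      forall t : R,
        cvg_as P (G t : nat -> T -> R[i]^o) (g t)%:C /\
        cvg_L2 P (@Normc.normc R) (G t) (g t)%:C].
Proof.
move=> _ gE g_le1 indU unifU A G.
pose D n w (l : 'I_(2 * b).+1) := sampling_error g (fun i => U i w) n l.
have mD n l : measurable_fun setT (fun w => D n w l).
  apply: measurable_funB => //; apply: measurableT_comp.
    by apply: continuous_measurable_fun; exact: field_continuous gE.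
  exact: measurable_order_stat.
have D_le n w l : `|D n w l| <= 1 + 1.
  by apply: le_trans (ler_normB _ _) _; rewrite lerD.
have D_cvg0 : {ae P, forall w l, D n w l @[n --> \oo] --> 0}.
  apply: filterS (sample_quantile_cvg_as P U indU unifU) => w Uw l.
  (* As l <= 2b, l s_b < (2b + 1) s_b = 1. *)
  have p01 : 0 <= l%:R * spacing R b < 1.
    rewrite mulr_ge0 ?(ltW (spacing_gt0 b)) //= -[ltRHS](spacing_unit b).
    by rewrite ltr_pM2r ?spacing_gt0 // ltr_nat.
  have := field_continuous _ _ gE (l%:R * spacing R b).
  move=> /(continuous_cvg _) /(_ (Uw _ p01)) h.
  by apply/subr_cvg0.
have ae_image m (C : 'M[R[i]]_(m, (2 * b).+1)) := linear_image_cvg_as P m _ C D D_cvg0.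
have L2_image m (C : 'M[R[i]]_(m, (2 * b).+1)) := linear_image_cvg_L2 P m _ C D _ mD D_le D_cvg0.
have AE n w : A n w - a = reconstruction_matrix *m \col_l (D n w l)%:C.
  exact: coef_estimate_error.
(* The modulus is the Euclidean norm of a vector of length 1, so the matrix lemmas cover the field
   too. *)
have GE t n w : Normc.normc (G t n w - (g t)%:C) ^+ 2 =
    euclidean_norm ((fourier_row t *m reconstruction_matrix) *m
      \col_l (D n w l)%:C) ^+ 2.
  by rewrite euclidean_norm_sqr1 -(field_estimate_error _ _ gE).
split.
- apply: filterS (ae_image _ reconstruction_matrix) => w h.
  by apply: cvg_complex_col; under eq_fun do rewrite AE.
- rewrite /cvg_L2; under eq_fun do under eq_fun do rewrite AE.
  exact: L2_image.
- move=> t; split.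
    apply: filterS (ae_image _ (fourier_row t *m reconstruction_matrix)) => w h.
    by apply: cvg_complex; under eq_fun do rewrite GE.
  rewrite /cvg_L2; under eq_fun do under eq_fun do rewrite GE.
  exact: L2_image.
Qed.
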